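(* There exist an ergodic system $(X,\mu,T)$ and an admissible semimetric $\rho$ on $(X,\mu)$ such that for every $\varepsilon>0$ there exists $\delta$ with $\varepsilon>\delta>0$ and $$\mathbb{H}_{\varepsilon}(X,\mu,T_{av}^n\rho)\ \lnsim\ \mathbb{H}_{\delta}(X,\mu,T_{av}^n\rho),$$ where both sides are regarded as sequences in $n\in\mathbb{N}$.
   Context: An ergodic system $(X,\mu,T)$ is a standard probability space $(X,\mu)$ with an invertible measure-preserving ergodic transformation $T$. A measurable semimetric on $(X,\mu)$ is a symmetric non-negative measurable function $\rho$ on $(X^2,\mu^2)$ satisfying the triangle inequality. $\varepsilon$-entropy: for $\varepsilon>0$, let $k$ be the minimal positive integer such that $X$ decomposes into a union of measurable sets $X_0,X_1,\dots,X_k$ with $\mu(X_0)<\varepsilon$ and $\operatorname{diam}_\rho(X_i)<\varepsilon$ for all $i>0$; put $\mathbb{H}_\varepsilon(X,\mu,\rho)=\log_2 k$, and $\mathbb{H}_\varepsilon(X,\mu,\rho)=+\infty$ if no such $k$ exists. A semimetric $\rho$ is admissible if $\mathbb{H}_\varepsilon(X,\mu,\rho)<+\infty$ for all $\varepsilon>0$. Averaged semimetric: $T_{av}^n\rho(x,y)=\frac1n\sum_{k=0}^{n-1}\rho(T^kx,T^ky)$ for $n\in\mathbb{N}=\{1,2,\dots\}$. For sequences $\phi,\psi$ of non-negative reals: $\phi\lesssim\psi$ means there is a constant $C>0$ with $\phi(n)\le C\psi(n)$ for all $n\in\mathbb{N}$; $\phi\asymp\psi$ means there are constants $c,C>0$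 with $c\phi(n)\le\psi(n)\le C\phi(n)$ for all $n\in\mathbb{N}$; $\phi\lnsim\psi$ means $\phi\lesssim\psi$ but not $\phi\asymp\psi$. *)

(* Defs.v *)
From HB Require Import structures.
From mathcomp Require Import all_boot all_order all_algebra.
From mathcomp Require Import all_classical all_reals all_analysis.

Set Implicit Arguments.
Unset Strict Implicit.
Unset Printing Implicit Defensive.

Import Order.TTheory GRing.Theory Num.Theory.
Import numFieldNormedType.Exports.

Local Open Scope classical_set_scope.
Local Open Scope ring_scope.

(* A standard Borel space: measurably isomorphic, via [f], to a Borel subset of
   the real line.  A standard probability space is a probability measure on a
   standard Borel space (atoms are allowed, the sigma-algebra is not
   completed). *)
Definition standard_borel (R : realType) (d : measure_display)
    (X : measurableType d) : Prop :=
  exists f : X -> measurableTypeR R,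
    [/\ injective f, measurable_fun setT f &
        forall A : set X, measurable A -> measurable (f @` A)].

Definition invertible_measurable (d : measure_display) (X : measurableType d)
    (T : X -> X) : Prop :=
  measurable_fun setT T /\
  exists S : X -> X, [/\ measurable_fun setT S, cancel T S & cancel S T].

Definition measure_preserving (R : realType) (d : measure_display)
    (X : measurableType d) (mu : probability X R) (T : X -> X) : Prop :=
  forall A : set X, measurable A -> mu (T @^-1` A) = mu A.

Definition ergodic (R : realType) (d : measure_display)
    (X : measurableType d) (mu : probability X R) (T : X -> X) : Prop :=
  forall A : set X, measurable A -> T @^-1` A = A ->
    mu A = 0%E \/ mu A = 1%E.

Definition ergodic_system (R : realType) (d : measure_display)
    (X : measurableType d) (mu : probability X R) (T : X -> X) : Prop :=
  [/\ standard_borel R X, invertible_measurable T,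
      measure_preserving mu T & ergodic mu T].

(* [rho (x, x) = 0] is not required; for an admissible semimetric it holds
   almost everywhere, because the diameter of a set involves its diagonal. *)
Definition measurable_semimetric (R : realType) (d : measure_display)
    (X : measurableType d) (rho : X * X -> R) : Prop :=
  [/\ measurable_fun setT rho,
      forall x y, 0 <= rho (x, y),
      forall x y, rho (x, y) = rho (y, x) &
      forall x y z, rho (x, z) <= rho (x, y) + rho (y, z)].

(* The empty set gets diameter -oo; only comparisons [diam rho A < eps] with
   [eps > 0] are ever used, so this is as good as 0. *)
Definition diam (R : realType) (X : Type) (rho : X * X -> R) (A : set X) :
    \bar R :=
  ereal_sup [set (rho p)%:E | p in A `*` A].

Definition eps_decomposition (R : realType) (d : measure_display)
    (X : measurableType d) (mu : probability X R) (rho : X * X -> R)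
    (eps : R) (k : nat) : Prop :=
  (0 < k)%N /\
  exists A : 'I_k.+1 -> set X,
    [/\ forall i, measurable (A i),
        \bigcup_i A i = setT,
        (mu (A ord0) < eps%:E)%E &
        forall i, i != ord0 -> (diam rho (A i) < eps%:E)%E].

Definition log2 (R : realType) (x : R) : R := ln x / ln 2.

Definition eps_entropy (R : realType) (d : measure_display)
    (X : measurableType d) (mu : probability X R) (rho : X * X -> R)
    (eps : R) : \bar R :=
  match pselect (exists k, `[< eps_decomposition mu rho eps k >]) with
  | left ex_k => (log2 (ex_minn ex_k)%:R)%:E
  | right _ => +oo%E
  end.

Definition admissible (R : realType) (d : measure_display)
    (X : measurableType d) (mu : probability X R) (rho : X * X -> R) : Prop :=
  measurable_semimetric rho /\
  forall eps : R, 0 < eps -> (eps_entropy mu rho eps < +oo)%E.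

Definition averaged (R : realType) (X : Type) (T : X -> X) (n : nat)
    (rho : X * X -> R) : X * X -> R :=
  fun p => n%:R^-1 * \sum_(k < n) rho (iter k T p.1, iter k T p.2).

(* Growth relations for sequences indexed by the positive integers.  The values
   are extended reals because entropies are; on finite values these are the
   usual relations between sequences of real numbers. *)
Definition growth_le (R : realType) (phi psi : nat -> \bar R) : Prop :=
  exists2 C : R, 0 < C &
    forall n, (0 < n)%N -> (phi n <= C%:E * psi n)%E.

Definition growth_eq (R : realType) (phi psi : nat -> \bar R) : Prop :=
  exists c C : R, [/\ 0 < c, 0 < C &
    forall n, (0 < n)%N ->
      (c%:E * phi n <= psi n)%E /\ (psi n <= C%:E * phi n)%E].

Definition growth_lt (R : realType) (phi psi : nat -> \bar R) : Prop :=
  growth_le phi psi /\ ~ growth_eq phi psi.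

(* Main.v *)
(* The system is a group extension of the dyadic odometer: a point carries
   odometer digits y_0, y_1, ... and fibre bits z_0, z_1, ..., and whenever
   adding 1 to y changes the digit y_l, the fibre bit with index [level l] is
   switched.  The semimetric sees only z, with weights decreasing in the index, so
   at scale eps only z_0, ..., z_{N-1} matter, while a smaller delta also sees z_N.
   The function [level] is constant on blocks [a, a^2), and every value is taken
   on arbitrarily far blocks.  On such a block with value N, take n = 2^(a^2).
   Along n steps the bits z_i with i < N depend on the first a digits of y, on the
   parities before and after the single carry past the block, and, up to a small
   proportion of times, on the approximate moment of that carry: the entropy at
   scale eps is at most a + O(1).  In contrast z_N behaves like a Thue-Morse
   sequence: two points whose digits agree below a and differ at some place of the
   block have z_N different for a fixed proportion of times, so the entropy at
   scale delta is at least a^2 - a - 2.  The ratio of the two is unbounded. *)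

Require Import Defs.
From HB Require Import structures.
From mathcomp Require Import all_boot all_order all_algebra.
From mathcomp Require Import all_classical all_reals all_analysis.
From mathcomp Require Import measurable_realfun.
From mathcomp Require Import zify ring lra.

Set Implicit Arguments.
Unset Strict Implicit.
Unset Printing Implicit Defensive.

Import Order.TTheory GRing.Theory Num.Theory.
Import numFieldNormedType.Exports.

(** * Combinatorics of the skew product *)

(* A point of [nat -> bool] encodes the pair (y, z) by y_l = x_{2l}, z_i = x_{2i+1}. *)
Definition base (x : nat -> bool) (l : nat) : bool := x l.*2.

Definition fiber (x : nat -> bool) (i : nat) : bool := x i.*2.+1.

(* If t = 2^i * odd and a = 2^2^t then [level] is i on all of [a, a^2). *)
Definition level (m : nat) : nat := logn 2 (trunc_log 2 (trunc_log 2 m)).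

Fixpoint carry (y : nat -> bool) (m : nat) : bool :=
  if m is m'.+1 then carry y m' && y m' else true.

(* The number of digits of y changed by adding 1; the junk value 0 stands for the
   point with all digits 1, whose digits all change. *)
Definition carries (y : nat -> bool) : nat :=
  match pselect (exists l, ~~ y l) with
  | left e => (ex_minn e).+1
  | right _ => 0
  end.

Definition level_parity (m i : nat) : bool :=
  \big[addb/false]_(l < m) (level l == i).

Definition skew (x : nat -> bool) (k : nat) : bool :=
  x k (+) (if odd k then level_parity (carries (base x)) k./2
           else carry (base x) k./2).

Definition bitsum (m : nat) (y : nat -> bool) : nat := \sum_(l < m) y l * 2 ^ l.

Definition bit_parity (i m : nat) (y : nat -> bool) : bool :=
  \big[addb/false]_(l < m) (y l && (level l == i)).

(* Constant along the orbit as long as no carry goes past the digit m - 1. *)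
Definition invariant_parity (i m : nat) (x : nat -> bool) : bool :=
  fiber x i (+) bit_parity i m (base x).

Implicit Types x y : nat -> bool.

(** * The odometer, its carries and the invariant parities *)

Lemma base_skew x l : base (skew x) l = base x l (+) carry (base x) l.
Proof. by rewrite /base /skew odd_double doubleK. Qed.

Lemma fiber_skew x i :
  fiber (skew x) i = fiber x i (+) level_parity (carries (base x)) i.
Proof. by rewrite /fiber /skew /= odd_double /= uphalf_double. Qed.

Lemma carryP y m : reflect (forall l, l < m -> y l) (carry y m).
Proof.
elim: m => [|m IH] /=; first by apply: ReflectT.
apply: (iffP andP) => [[/IH h ym] l|h].
  by rewrite ltnS leq_eqVlt => /orP[/eqP->|/h].
by split; [apply/IH => l lm; apply: h; rewrite ltnS ltnW|exact: h].
Qed.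

Lemma eq_carry y y' m : (forall l, l < m -> y l = y' l) -> carry y m = carry y' m.
Proof.
move=> e; apply/carryP/carryP => h l lm; first by rewrite -e// h.
by rewrite e// h.
Qed.

(** The hypothesis excludes the point with all digits 1, where [carries] has its junk value. *)
Lemma carriesP y m : ~~ carry y m -> forall l, (l < carries y) = carry y l.
Proof.
move=> nc l; rewrite /carries; case: pselect => [e|ne].
  case: ex_minnP => v nyv vmin; rewrite ltnS; apply/idP/carryP => [lv r rl|h].
    by apply: contraT => /vmin; rewrite leqNgt (leq_trans rl lv).
  by rewrite leqNgt; apply/negP => /h; apply/negP.
by case/carryP: nc => r _; apply: contraT => nyr; case: ne; exists r.
Qed.

Lemma level_parity_carries y m i : ~~ carry y m ->
  level_parity (carries y) i = \big[addb/false]_(l < m) (carry y l && (level l == i)).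
Proof.
move=> nc; have cm : carries y <= m by rewrite leqNgt (carriesP nc).
rewrite /level_parity (big_ord_widen m (fun l => level l == i) cm) big_mkcond.
by apply: eq_bigr => l _; rewrite (carriesP nc); case: carry.
Qed.

(** The first m digits form a binary counter modulo 2^m, and [carry (base x) m] is its overflow. *)
Lemma bitsum_skew m x :
  bitsum m (base (skew x)) + 2 ^ m * carry (base x) m = (bitsum m (base x)).+1.
Proof.
rewrite /bitsum; elim: m => [|m IH]; first by rewrite !big_ord0.
rewrite !big_ord_recr /= base_skew -addSn -IH expnS.
move: (\sum_(i < m) _) (2 ^ m) => s p.
by clear IH; case: carry; case: (base x m) => /=; lia.
Qed.

Lemma bitsum_lt m y : bitsum m y < 2 ^ m.
Proof.
rewrite /bitsum; elim: m => [|m IH]; first by rewrite big_ord0.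
rewrite big_ord_recr /= expnS; move: (\sum_(i < m) _) (2 ^ m) IH => s p.
by case: (y m) => /=; lia.
Qed.

Lemma bitsumS m y : bitsum m.+1 y = bitsum m y + y m * 2 ^ m.
Proof. by rewrite /bitsum big_ord_recr. Qed.

Lemma eq_bit_parity i m y y' :
  (forall l, l < m -> level l == i -> y l = y' l) ->
  bit_parity i m y = bit_parity i m y'.
Proof.
by move=> e; apply: eq_bigr => l _; case: eqP => [/eqP /e ->//|_]; rewrite !andbF.
Qed.

Lemma bit_parity_stable i m n y : m <= n ->
  (forall l, m <= l < n -> level l != i) -> bit_parity i n y = bit_parity i m y.
Proof.
move=> mn h; rewrite /bit_parity.
rewrite (big_ord_widen n (fun l => y l && (level l == i)) mn) [RHS]big_mkcond /=.
apply: eq_bigr => l _; case: ltnP => // ml.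
by rewrite (negbTE (h l _)) ?andbF// ml ltn_ord.
Qed.

(** A digit changes exactly when the carry reaches it; if the carry stops below m, all changed
    digits are counted on both sides. *)
Lemma bit_parity_skew i m x : ~~ carry (base x) m ->
  bit_parity i m (base (skew x)) =
  bit_parity i m (base x) (+) level_parity (carries (base x)) i.
Proof.
move=> nc; rewrite (level_parity_carries _ nc) -big_split /=.
by apply: eq_bigr => l _; rewrite base_skew -andb_addl.
Qed.

Lemma invariant_parity_skew i m x : ~~ carry (base x) m ->
  invariant_parity i m (skew x) = invariant_parity i m x.
Proof.
move=> nc; rewrite /invariant_parity fiber_skew bit_parity_skew//.
by rewrite addbAC -!addbA addbb addbF.
Qed.

(** Until the counter on m digits overflows, each step changes a fibre bit and the corresponding
    digit parity together. *)
Lemma iter_skew_no_overflow m k x : bitsum m (base x) + k < 2 ^ m ->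
  [/\ forall i, invariant_parity i m (iter k skew x) = invariant_parity i m x,
      bitsum m (base (iter k skew x)) = bitsum m (base x) + k &
      forall l, m <= l -> base (iter k skew x) l = base x l].
Proof.
elim: k => [|k IH] h; first by split=> //; rewrite addn0.
have [IS IY Ib] := IH ltac:(by lia).
have nc : ~~ carry (base (iter k skew x)) m.
  apply/negP => c; have := bitsum_skew m (iter k skew x).
  by rewrite c IY; lia.
split=> [i||l ml].
- by rewrite iterS invariant_parity_skew.
- have := bitsum_skew m (iter k skew x).
  by rewrite (negbTE nc) muln0 addn0 iterS => ->; rewrite IY addnS.
- rewrite iterS base_skew Ib//; case: carryP => [c|_]; last by rewrite addbF.
  by case/carryP: nc => r rm; apply: c; apply: leq_trans ml.
Qed.

(** * Addition of powers of two *)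

(** Adding 2^v starts a carry at the digit v; this says that it reaches the digit l. *)
Definition carry_from (v : nat) (y : nat -> bool) (l : nat) : bool :=
  (v <= l) && carry (fun r => y (v + r)) (l - v).

Lemma carry_fromP v y l :
  reflect (v <= l /\ forall r, v <= r < l -> y r) (carry_from v y l).
Proof.
apply: (iffP andP) => -[vl].
  move=> /carryP c; split=> // r /andP[vr rl].
  by have := c (r - v); rewrite subnKC//; apply; lia.
by move=> h; split=> //; apply/carryP => r rl; apply: h; lia.
Qed.

(** Adding 2^(v+1) is adding 2^v twice. The digit v is flipped in between, so exactly one of the two
    carries gets past it, and that one continues from v+1. *)
Lemma base_iter_skew_pow v x l :
  base (iter (2 ^ v) skew x) l = base x l (+) carry_from v (base x) l.
Proof.
elim: v x l => [|v IH] x l.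
  by rewrite expn0 /= base_skew /carry_from subn0.
rewrite expnS mul2n -addnn iterD !IH -addbA; congr (_ (+) _).
case: (ltngtP l v) => [lv|vl|->].
- by rewrite /carry_from [v <= l]leqNgt lv [v < l]ltnNge (ltnW lv).
- have e r : v < r -> base (iter (2 ^ v) skew x) r =
      base x r (+) carry_from v (base x) r by move=> _; exact: IH.
  have e0 : base (iter (2 ^ v) skew x) v = ~~ base x v.
    by rewrite IH /carry_from leqnn subnn addbT.
  case xv : (base x v).
    have -> : carry_from v (base (iter (2 ^ v) skew x)) l = false.
      apply/negP => /carry_fromP[_ /(_ v)]; rewrite leqnn vl e0 xv => h.
      by have := h isT.
    rewrite addbF; apply/carry_fromP/carry_fromP => -[_ h]; (split; first by lia).
      by move=> r ?; apply: h; lia.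
    by move=> r /andP[]; rewrite leq_eqVlt => /orP[/eqP<-//|vr rl]; apply: h; rewrite vr.
  have nv r : v < r -> carry_from v (base x) r = false.
    by move=> vr; apply/negP => /carry_fromP[_ /(_ v)]; rewrite leqnn vr xv => h; have := h isT.
  rewrite nv//; apply/carry_fromP/carry_fromP => -[_ h]; (split; first by lia).
  + by move=> r /andP[vr rl]; rewrite -(addbF (base x r)) -(nv r)// -IH h// rl ltnW.
  + move=> r /andP[]; rewrite leq_eqVlt => /orP[/eqP<- _|vr rl]; first by rewrite e0 xv.
    by rewrite IH nv// addbF h// vr.
- by rewrite /carry_from leqnn subnn ltnn.
Qed.

(** The digit v absorbs the carry, so the counter on v+1 digits does not overflow, and the invariant
    parity there gives the change of the fibre without following the 2^v steps. *)
Lemma iter_skew_flip v x : ~~ base x v ->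
  (forall l, base (iter (2 ^ v) skew x) l = base x l (+) (l == v)) /\
  (forall i, fiber (iter (2 ^ v) skew x) i = fiber x i (+) (level v == i)).
Proof.
move=> xv.
have eb l : base (iter (2 ^ v) skew x) l = base x l (+) (l == v).
  rewrite base_iter_skew_pow; congr (_ (+) _).
  apply/carry_fromP/eqP => [[vl h]|->]; last by split=> // r; lia.
  apply/eqP; rewrite eqn_leq vl andbT leqNgt; apply/negP => lv.
  by move: xv; rewrite h// leqnn.
split=> // i.
have [|e _ _] := @iter_skew_no_overflow v.+1 (2 ^ v) x.
  by rewrite bitsumS (negbTE xv) expnS; have := bitsum_lt v (base x); lia.
have := e i; rewrite /invariant_parity /bit_parity !big_ord_recr /=.
rewrite eb (negbTE xv) eqxx /=.
under eq_bigr => l _ do rewrite eb (ltn_eqF (ltn_ord l)) addbF.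
by move: (\big[addb/false]_(_ < _) _) (fiber _ _) (fiber _ _) (level v == i)
  => [] [] [] [].
Qed.

(** The carry flips the digits v and v+1 and stops; the invariant parity at v+2 gives the change of
    the fibre. *)
Lemma fiber_iter_skew_two v x i : base x v -> ~~ base x v.+1 ->
  fiber (iter (2 ^ v) skew x) i =
  fiber x i (+) (level v == i) (+) (level v.+1 == i).
Proof.
move=> xv xv1.
have [|e _ _] := @iter_skew_no_overflow v.+2 (2 ^ v) x.
  rewrite 2!bitsumS xv (negbTE xv1) !expnS.
  by have := bitsum_lt v (base x); lia.
have eb l : base (iter (2 ^ v) skew x) l = base x l (+) ((l == v) || (l == v.+1)).
  rewrite base_iter_skew_pow; congr (_ (+) _).
  apply/carry_fromP/orP => [[vl h]|[]/eqP->].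
  - case: (ltngtP l v.+1) => [lv|lv|->]; [left|exfalso|by right].
      by rewrite eqn_leq vl andbT -ltnS.
    by move: xv1; rewrite h// leqnSn.
  - by split=> // r; lia.
  - by split=> // r; rewrite ltnS -eqn_leq => /eqP <-.
have := e i; rewrite /invariant_parity /bit_parity !big_ord_recr /=.
rewrite !eb xv (negbTE xv1) !eqxx (ltn_eqF (ltnSn v)) orbT /=.
under eq_bigr => l _.
  rewrite eb (ltn_eqF (ltn_ord l)) (ltn_eqF (ltnW _)); last by rewrite ltnS.
  rewrite addbF.
  over.
by move: (\big[addb/false]_(_ < _) _) (fiber _ _) (fiber _ _) (level v == i)
  (level v.+1 == i) => [] [] [] [] [].
Qed.

Lemma eq_base_iter_skew m x x' k : (forall l, l < m -> base x l = base x' l) ->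
  forall l, l < m -> base (iter k skew x) l = base (iter k skew x') l.
Proof.
move=> e; elim: k => // k IH l lm; rewrite !iterS !base_skew IH//.
by congr (_ (+) _); apply: eq_carry => r rl; apply: IH; apply: ltn_trans lm.
Qed.

Lemma iter_iter (A : Type) (f : A -> A) m n z : iter m (iter n f) z = iter (m * n) f z.
Proof. by elim: m => //= m ->; rewrite mulSn iterD. Qed.

(** * Separation of orbits inside a block *)

(* Adding 2^v switches z_i when y_v = 0, and switches it twice when y_v = 1 and
   y_{v+1} = 0; within three such steps the two orbits fall into this situation,
   which changes whether their i-th fibre bits agree. *)
Lemma skew_separates_4steps v i x x' :
  level v = i -> level v.+1 = i -> base x v != base x' v ->
  exists2 p, p < 4 & fiber (iter (p * 2 ^ v) skew x) i !=
                     fiber (iter (p * 2 ^ v) skew x') i.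
Proof.
move=> lv lv1; wlog xv : x x' / ~~ base x v => [wl|].
  case xv : (base x v); last by rewrite -xv; apply: wl; rewrite xv.
  move=> xx'.
  have [||p p4 h] := wl x' x; [|by rewrite xv eq_sym|by exists p; rewrite 1?eq_sym].
  by move: xx'; case: base.
rewrite (negbTE xv); case x'v : (base x' v) => // _.
pose S := iter (2 ^ v) skew.
have bv u : base (S u) v = ~~ base u v.
  by rewrite base_iter_skew_pow /carry_from leqnn subnn addbT.
have bv1 u : base (S u) v.+1 = base u v.+1 (+) base u v.
  by rewrite base_iter_skew_pow /carry_from leqnSn subSnn /= addn0.
have f0 u : ~~ base u v -> fiber (S u) i = ~~ fiber u i.
  by move=> uv; rewrite (iter_skew_flip uv).2 lv eqxx addbT.
have f1 u : base u v -> ~~ base u v.+1 -> fiber (S u) i = fiber u i.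
  by move=> uv uv1; rewrite fiber_iter_skew_two// lv lv1 eqxx !addbT negbK.
have split_change u u' : fiber (S u) i (+) fiber (S u') i = ~~ (fiber u i (+) fiber u' i) ->
    (fiber u i != fiber u' i) || (fiber (S u) i != fiber (S u') i).
  by move: (fiber u i) (fiber u' i) (fiber (S u) i) (fiber (S u') i) => [] [] [] [].
pose P p := fiber (iter p S x) i != fiber (iter p S x') i.
suff [p p4 Pp] : exists2 p, p < 4 & P p by exists p => //; move: Pp; rewrite /P !iter_iter.
case x'v1 : (base x' v.+1); last first.
  have /orP[h|h] : P 0 || P 1.
  - by apply: split_change; rewrite f0// f1 ?x'v ?x'v1// addNb.
  - by exists 0.
  - by exists 1.
case xv1 : (base x v.+1); last first.
  have /orP[h|h] : P 1 || P 2.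
  - apply: split_change => /=; rewrite [in X in X (+) _]f1 ?bv ?bv1 ?(negbTE xv) ?xv1//.
    by rewrite [in X in _ (+) X]f0 ?bv ?x'v// addbN.
  - by exists 1.
  - by exists 2.
have /orP[h|h] : P 2 || P 3.
- apply: split_change => /=.
  rewrite [in X in X (+) _]f0 ?bv ?(negbTE xv)//.
  by rewrite [in X in _ (+) X]f1 ?bv ?bv1 ?bv ?x'v ?x'v1// addNb.
- by exists 2.
- by exists 3.
Qed.

Lemma leq_sum_shift m n c (F : nat -> nat) : m + c <= n ->
  \sum_(k < m) F (k + c) <= \sum_(k < n) F k.
Proof.
move=> mcn; rewrite -(big_mkord xpredT (fun k => F (k + c))) -(big_mkord xpredT F).
rewrite -[m in X in X <= _](addnK c) -(big_addn 0 (m + c) c xpredT F) add0n.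
rewrite [X in _ <= X](@big_cat_nat _ _ _ c)//=; last by lia.
by rewrite [X in _ <= _ + X](@big_cat_nat _ _ _ (m + c))//=; lia.
Qed.

(** Among the times k + p * 2^v with p < 4 at least one shows a disagreement. Summing over k < 2^b -
    3 * 2^v, which is at least a quarter of all times, counts each disagreement at most four times;
    hence the factor 16. *)
Lemma skew_separates b v i x x' : v.+1 < b -> level v = i -> level v.+1 = i ->
  (forall l, l < v -> base x l = base x' l) -> base x v != base x' v ->
  2 ^ b <= 16 * \sum_(k < 2 ^ b) (fiber (iter k skew x) i != fiber (iter k skew x') i).
Proof.
move=> vb lv lv1 low xv.
pose D k : nat := fiber (iter k skew x) i != fiber (iter k skew x') i.
have D4 k : 1 <= D (k + 0 * 2 ^ v) + D (k + 1 * 2 ^ v) + D (k + 2 * 2 ^ v) + D (k + 3 * 2 ^ v).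
  (* The digits below v agree along both orbits, so the carries into v agree and the difference at v
     persists. *)
  have kv : base (iter k skew x) v != base (iter k skew x') v.
    elim: k => // k IH; rewrite !iterS !base_skew.
    rewrite (@eq_carry _ (base (iter k skew x'))); last exact: eq_base_iter_skew.
    by move: IH; case: base; case: base; case: carry.
  have [p p4 h] := skew_separates_4steps lv lv1 kv.
  have : D (k + p * 2 ^ v) = 1 by rewrite /D addnC !iterD h.
  by case: p p4 {h} => [|[|[|[|p]]]]//= _ ->; lia.
have e2 : 2 ^ b = 2 ^ (b - v.+2) * 4 * 2 ^ v.
  by rewrite -mulnA -(expnD 2 2) -expnD; congr (2 ^ _); lia.
have e1 : 0 < 2 ^ (b - v.+2) by rewrite expn_gt0.
have e3 : 4 * 2 ^ v <= 2 ^ b by rewrite e2 leq_mul2r; lia.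
set m := 2 ^ b - 3 * 2 ^ v.
have key : m <= \sum_(k < m) (D (k + 0 * 2 ^ v) + D (k + 1 * 2 ^ v) +
     D (k + 2 * 2 ^ v) + D (k + 3 * 2 ^ v)).
  by rewrite -[X in X <= _]card_ord -sum1_card; apply: leq_sum => k _.
rewrite !big_split /= in key.
have h p : p < 4 -> \sum_(k < m) D (k + p * 2 ^ v) <= \sum_(k < 2 ^ b) D k.
  move=> p4; apply: leq_sum_shift.
  have : p * 2 ^ v <= 3 * 2 ^ v by rewrite leq_mul2r; lia.
  by rewrite /m; lia.
have := h 0 isT; have := h 1 isT; have := h 2 isT; have := h 3 isT.
move: (\sum_(k < m) _) (\sum_(k < m) _) (\sum_(k < m) _) (\sum_(k < m) _) key
  (\sum_(k < 2 ^ b) _) => s0 s1 s2 s3; rewrite /m; move: (2 ^ b) (2 ^ v) e3 => B V.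
lia.
Qed.

(** * Agreement of the low fibre bits along a block *)

Lemma sum_itv_le n lo hi : \sum_(k < n) (lo <= k < hi) <= hi - lo.
Proof.
elim: n => [|n IH]; first by rewrite big_ord0.
(* The bound with [minn] is the one that passes through the induction. *)
have : \sum_(k < n.+1) (lo <= k < hi) <= minn n.+1 hi - lo; last by lia.
elim: {IH} n.+1 => [|m IH]; first by rewrite big_ord0.
by rewrite big_ord_recr /=; move: IH; move: (\sum_(i < m) _) => s; lia.
Qed.

Lemma bitsum_eq_above c m y y' : c <= m -> (forall l, c <= l < m -> y l = y' l) ->
  bitsum m y + bitsum c y' = bitsum m y' + bitsum c y.
Proof.
elim: m => [|m IH].
  by rewrite leqn0 => /eqP-> _; rewrite addnC.
rewrite leq_eqVlt => /orP[/eqP-> _|]; first by rewrite addnC.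
rewrite ltnS => cm e; rewrite !bitsumS e ?cm ?ltnSn// addnAC IH//; last first.
  by move=> l /andP[cl lm]; rewrite e// cl ltnW.
by rewrite addnAC.
Qed.

Lemma fiber_invariant i m x : fiber x i = invariant_parity i m x (+) bit_parity i m (base x).
Proof. by rewrite /invariant_parity -addbA addbb addbF. Qed.

(** For i < N the digit parities depend only on digits below a, so fibre bits agree exactly when the
    invariant parities do. These are constant before and after the single overflow, so agreement at
    the times 0 and 2^b suffices except between the two overflow moments. The common top q digits
    keep that gap short. *)
Lemma skew_agreement N a b q x x' : a <= b -> q <= b ->
  (forall l, a <= l < b -> N <= level l) ->
  (forall l, l < a -> base x l = base x' l) ->
  (forall l, b - q <= l < b -> base x l = base x' l) ->
  (forall i, i < N -> fiber x i = fiber x' i) ->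
  (forall i, i < N -> fiber (iter (2 ^ b) skew x) i = fiber (iter (2 ^ b) skew x') i) ->
  exists B : nat -> bool,
    \sum_(k < 2 ^ b) B k <= 2 ^ (b - q) /\
    forall k i, k < 2 ^ b -> i < N -> ~~ B k ->
      fiber (iter k skew x) i = fiber (iter k skew x') i.
Proof.
move=> ab qb lev low high; wlog le : x x' low high / bitsum b (base x) <= bitsum b (base x').
  move=> wl fx fTx; case/orP: (leq_total (bitsum b (base x)) (bitsum b (base x'))) => le.
    exact: wl.
  have [B [h1 h2]] := wl x' x (fun l h => esym (low l h)) (fun l h => esym (high l h))
    le (fun i h => esym (fx i h)) (fun i h => esym (fTx i h)).
  by exists B; split=> // k i kb iN Bk; rewrite h2.
move=> fx fTx.
have par k i : i < N -> bit_parity i b (base (iter k skew x)) =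
                      bit_parity i b (base (iter k skew x')).
  move=> iN; have st y : bit_parity i b y = bit_parity i a y.
    apply: bit_parity_stable => // l /lev Nl; apply/eqP => li.
    by move: iN; rewrite -li ltnNge Nl.
  by rewrite !st; apply: eq_bit_parity => l la _; apply: (eq_base_iter_skew k low).
have inv0 i : i < N -> invariant_parity i b x = invariant_parity i b x'.
  by move=> iN; rewrite /invariant_parity fx// (par 0).
have invT i : i < N -> invariant_parity i b (iter (2 ^ b) skew x) =
                      invariant_parity i b (iter (2 ^ b) skew x').
  by move=> iN; rewrite /invariant_parity fTx// par.
(* The exceptional times: x' has already overflowed and x has not. *)
exists (fun k => 2 ^ b - bitsum b (base x') <= k < 2 ^ b - bitsum b (base x)).
have ltx := bitsum_lt b (base x); have ltx' := bitsum_lt b (base x').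
split.
  apply: leq_trans (sum_itv_le _ _ _) _.
  have := bitsum_eq_above (leq_subr q b) high.
  by have := bitsum_lt (b - q) (base x'); lia.
have after u k : k < 2 ^ b -> 2 ^ b <= bitsum b (base u) + k ->
  forall i, invariant_parity i b (iter k skew u) = invariant_parity i b (iter (2 ^ b) skew u).
  move=> kb; have ltu := bitsum_lt b (base u).
  (* The last time before the overflow. One step later the counter stands at 0, so it cannot
     overflow again up to the time 2^b. *)
  pose c := 2 ^ b - bitsum b (base u) - 1 => h.
  have [_ Yc _] := @iter_skew_no_overflow b c u ltac:(by rewrite /c; lia).
  have Yc1 : bitsum b (base (iter c.+1 skew u)) = 0.
    have := bitsum_skew b (iter c skew u); rewrite Yc -iterS.
    have := bitsum_lt b (base (iter c.+1 skew u)).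
    by case: carry; rewrite ?muln1 ?muln0 /c; lia.
  have inv n : n <= 2 ^ b -> c.+1 <= n -> forall i,
      invariant_parity i b (iter n skew u) = invariant_parity i b (iter c.+1 skew u).
    move=> nb cn i; rewrite -{1}(subnK cn) iterD.
    have [|-> _ _//] := @iter_skew_no_overflow b (n - c.+1) (iter c.+1 skew u).
    by rewrite Yc1 /c; lia.
  by move=> i; rewrite inv ?inv//; rewrite /c; lia.
move=> k i kb iN; rewrite negb_and -ltnNge -leqNgt => /orP[h|h].
  rewrite !(fiber_invariant i b) par//; congr (_ (+) _).
  have [|-> _ _] := @iter_skew_no_overflow b k x; first by lia.
  have [|-> _ _] := @iter_skew_no_overflow b k x'; first by lia.
  exact: inv0.
rewrite !(fiber_invariant i b) par//; congr (_ (+) _).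
by rewrite after ?after ?invT//; lia.
Qed.

(** * Blocks of constant level *)

Lemma level_block i c : exists2 a, c <= a & forall l, a <= l < a * a -> level l = i.
Proof.
(* The odd factor keeps the 2-adic valuation i and pushes the block beyond c. *)
pose t := 2 ^ i * (2 * c).+1; exists (2 ^ (2 ^ t)).
  have ct : c <= t by rewrite /t; have : 0 < 2 ^ i := expn_gt0 2 i; nia.
  apply: leq_trans ct _; apply: leq_trans (ltnW (ltn_expl t (ltnSn 1))) _.
  exact: ltnW (ltn_expl _ (ltnSn 1)).
move=> l /andP[al]; rewrite -expnD addnn -muln2 -expnSr => lb.
have l0 : 0 < l by apply: leq_trans al; rewrite expn_gt0.
rewrite /level (@trunc_log_eq _ t) //; last first.
  apply/andP; split; first exact: trunc_log_max.
  by rewrite -(ltn_exp2l _ _ (ltnSn 1)); apply: leq_ltn_trans lb; exact: trunc_logP.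
rewrite lognM ?expn_gt0// pfactorK// [logn 2 _.+1]logn_coprime ?addn0//.
by rewrite coprime2n /= oddM.
Qed.

Local Open Scope classical_set_scope.
Local Open Scope ring_scope.

(** * The coin-tossing space *)

Definition bit_sets : set (set (nat -> bool)) := [set [set x : nat -> bool | x k] | k in setT].

Definition bits := g_sigma_algebraType bit_sets.
HB.instance Definition _ := Measurable.on bits.

Lemma measurable_bit k : measurable [set x : bits | x k].
Proof. by apply: sub_sigma_algebra; exists k. Qed.

Lemma measurable_bitE k b : measurable [set x : bits | x k = b].
Proof.
case: b; first exact: measurable_bit.
rewrite (_ : [set _ | _] = ~` [set x : bits | x k]).
  exact: measurableC (measurable_bit k).
by apply/seteqP; split => x /=; case: (x k).
Qed.

Lemma measurable_to_bits d (A : measurableType d) (f : A -> bits) :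
  (forall k, measurable [set t | f t k]) -> measurable_fun setT f.
Proof.
move=> mf; have := @measurability _ _ A bits setT f bit_sets erefl; apply.
by move=> _ [_ [k _ <-] <-]; rewrite setTI; exact: mf.
Qed.

(** Translation by [g] in the group of bit sequences; [skew] is piecewise of this form. *)
Definition flip (g : nat -> bool) (x : bits) : bits := fun k => g k (+) x k.

Lemma flipK g : cancel (flip g) (flip g).
Proof. by move=> x; apply/funext => k; rewrite /flip addbA addbb. Qed.

Lemma measurable_flip g : measurable_fun setT (flip g : bits -> bits).
Proof.
apply: measurable_to_bits => k; rewrite /flip.
rewrite (_ : [set t : bits | _] = [set t | t k = ~~ g k]); first exact: measurable_bitE.
by apply/seteqP; split => x /=; case: (g k); case: (x k).
Qed.

Definition single (l : nat) : nat -> bool := fun k => k == l.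

Definition cylinder (n : nat) (w : nat -> bool) : set bits :=
  [set x | forall k, (k < n)%N -> x k = w k].

Lemma cylinderS n w : cylinder n.+1 w = cylinder n w `&` [set x : bits | x n = w n].
Proof.
apply/seteqP; split => x /=; first by move=> h; split=> [k kn|]; apply: h; lia.
by move=> [h e] k; rewrite ltnS leq_eqVlt => /orP[/eqP->|/h].
Qed.

Lemma measurable_cylinder n w : measurable (cylinder n w).
Proof.
elim: n => [|n IH]; last first.
  by rewrite cylinderS; apply: measurableI => //; exact: measurable_bitE.
by rewrite (_ : cylinder 0 w = setT)//; apply/seteqP; split.
Qed.

(** * Cylinders and fair measures *)

(** The empty set is added to obtain a pi-system. *)
Definition cylinders : set (set bits) :=
  [set A | A = set0 \/ exists n w, A = cylinder n w].

Lemma cylinder_setI n m w w' : (n <= m)%N ->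
  cylinders (cylinder n w `&` cylinder m w').
Proof.
move=> nm; case: (pselect (cylinder n w w')) => [h|h]; last left.
  right; exists m, w'; apply/seteqP; split => x /=; first by case.
  by move=> hx; split=> // k kn; rewrite hx ?h//; apply: leq_trans nm.
apply/seteqP; split => // x [/= h1 h2]; apply: h => k kn.
by rewrite -h1// h2//; apply: leq_trans nm.
Qed.

Lemma cylinders_setI : setI_closed cylinders.
Proof.
move=> A B [->|[n [w ->]]]; first by rewrite set0I; left.
move=> [->|[m [w' ->]]]; first by rewrite setI0; left.
by case/orP: (leq_total n m) => h; [|rewrite setIC]; exact: cylinder_setI.
Qed.

Lemma measurable_cylindersE : (measurable : set (set bits)) = <<s cylinders >>.
Proof.
apply/seteqP; split; last first.
  apply: smallest_sub; first exact: sigma_algebra_measurable.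
  by move=> A [->|[n [w ->]]] //; exact: measurable_cylinder.
apply: smallest_sub; first exact: smallest_sigma_algebra.
move=> _ [k _ <-].
(* A coordinate set is the union of the cylinders given by finite words with the letter 1 at place
   k; there are countably many words, enumerated by [unpickle]. *)
pose part (o : option (seq bool)) : set (nat -> bool) :=
  if o is Some s then if nth false s k then cylinder k.+1 (nth false s) else set0
  else set0.
have part_cyl o : cylinders (part o).
  case: o => [s|] /=; last by left.
  by case: ifP => _; [right; exists k.+1, (nth false s)|left].
pose word (i : nat) : option (seq bool) := unpickle i.
have wordK s : word (pickle s) = Some s by exact: pickleK.
rewrite (_ : [set x : nat -> bool | x k] = \bigcup_i part (word i)).
  by apply: sigma_algebra_bigcup => i; exact: sub_sigma_algebra.
apply/seteqP; split => [x /= xk|x [i _]].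
  suff h : part (Some (mkseq x k.+1)) x.
    by exists (pickle (mkseq x k.+1)) => //; move: h; rewrite -wordK.
  by rewrite /part nth_mkseq// xk => l lk; rewrite nth_mkseq.
by rewrite /part; move: (word i) => [s|//]; case: ifP => // sk h; rewrite /= h.
Qed.

Lemma measure_cylinderS (R : realType) (m : {measure set bits -> \bar R}) n w :
  (m (cylinder n w) = m (cylinder n.+1 w) + m (cylinder n.+1 (flip (single n) w)))%E.
Proof.
rewrite -measureU; [|exact: measurable_cylinder|exact: measurable_cylinder|].
  congr (m _); rewrite !cylinderS; apply/seteqP; split => x /=; last first.
    case=> -[h _] k kn; rewrite h// /flip /single.
    by rewrite (ltn_eqF kn).
  move=> h; have e : cylinder n (flip (single n) w) x.
    by move=> k kn; rewrite h// /flip /single (ltn_eqF kn).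
  by rewrite /flip /single eqxx /=; case: (x n); case: (w n); [left|right|right|left].
rewrite !cylinderS; apply/seteqP; split => // x [[_ /= ->] [_ /=]].
by rewrite /flip /single eqxx; case: (w n).
Qed.

(* Swapping the two halves of every cylinder forces the coin-tossing measure. *)
Definition fair (R : realType) (m : set bits -> \bar R) : Prop :=
  forall n w, m (cylinder n.+1 (flip (single n) w)) = m (cylinder n.+1 w).

(** By induction the total mass determines the mass of each cylinder, and cylinders form a
    generating pi-system. The mass is not fixed to be 1 because ergodicity applies this to the
    restriction of a measure to an invariant set. *)
Lemma fair_measure_unique (R : realType) (m1 m2 : {measure set bits -> \bar R}) :
  fair m1 -> fair m2 -> (m1 setT < +oo)%E -> m1 setT = m2 setT ->
  forall A : set bits, measurable A -> m1 A = m2 A.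
Proof.
move=> f1 f2 fin eT.
have cyl n w : m1 (cylinder n w) = m2 (cylinder n w).
  elim: n w => [|n IH] w.
    by rewrite (_ : cylinder 0 w = setT)//; apply/seteqP; split.
  have := IH w; rewrite (measure_cylinderS m1) (measure_cylinderS m2) f1 f2.
  case: (m1 _) (m2 _) => [a||] [b||] //= [] h.
  by congr EFin; lra.
apply: (@measure_unique _ _ _ cylinders (fun=> setT)) => //.
- exact: measurable_cylindersE.
- exact: cylinders_setI.
- by move=> _; right; exists 0%N, (fun=> false); apply/seteqP; split.
- by apply/seteqP; split => // x _; exists 0%N.
- by move=> A [->|[n [w ->]]]; rewrite ?measure0.
Qed.

Lemma flip_cylinder g n w : flip g @^-1` cylinder n w = cylinder n (flip g w).
Proof.
by apply/seteqP; split => x /= h k kn; [rewrite /flip -(h k kn) /flip|rewrite /flip (h k kn) /flip];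
  rewrite addbA addbb.
Qed.

(** * Binary digits and the coin-tossing measure *)

(* [digits 2] and [digits 3] read off the base 2 expansion and the base 3
   expansion with digits 0 and 2. *)
Definition expand (R : realType) (c r : R) : R :=
  c * r - (if 2^-1 <= r then c - 1 else 0).

Definition digits (R : realType) (c : R) (r : measurableTypeR R) : bits :=
  fun k => 2^-1 <= iter k (expand c) r.

Lemma measurable_expand (R : realType) (c : R) : measurable_fun setT (expand c).
Proof.
rewrite /expand; apply: measurable_funB; first exact: measurable_funM.
by apply: measurable_fun_ifT => //; exact: measurable_fun_ler.
Qed.

Lemma measurable_digits (R : realType) (c : R) :
  measurable_fun setT (digits c : R -> bits).
Proof.
apply: measurable_to_bits => k.
have mk : measurable_fun setT (iter k (expand c)).
  elim: k => [|k IH]; first exact: measurable_id.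
  exact: measurableT_comp (measurable_expand c) IH.
rewrite (_ : [set _ | _] = iter k (expand c) @^-1` `[2^-1, +oo[).
  by rewrite -[X in measurable X]setTI; exact: mk.
by apply/seteqP; split => r /=; rewrite in_itv /= andbT.
Qed.

HB.instance Definition _ (g : nat -> bool) :=
  @isMeasurableFun.Build _ _ bits bits (flip g) (measurable_flip g).

HB.instance Definition _ (R : realType) (c : R) :=
  @isMeasurableFun.Build _ _ (measurableTypeR R) bits (digits c) (measurable_digits c).

(** Translations commute, so the image of a fair measure under [flip g] is again fair, and
    uniqueness applies. *)
Lemma fair_probability_flip (R : realType) (m : probability bits R) g (A : set bits) :
  fair m -> measurable A -> m (flip g @^-1` A) = m A.
Proof.
move=> fm mA; suff h : distribution m (flip g) A = m A by exact: h.
apply: fair_measure_unique => //.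
- move=> n w; transitivity (m (cylinder n.+1 (flip g (flip (single n) w)))).
    exact: (congr1 m (flip_cylinder g _ _)).
  transitivity (m (cylinder n.+1 (flip g w))); last exact: (congr1 m (esym (flip_cylinder g _ _))).
  have -> : flip g (flip (single n) w) = flip (single n) (flip g w).
    by apply/funext => k; rewrite /flip addbCA.
  exact: fm.
- exact: (le_lt_trans (probability_le1 m (@measurableT _ bits)) (ltry 1)).
Qed.

Definition unit_lebesgue (R : realType) : set (measurableTypeR R) -> \bar R :=
  mrestr lebesgue_measure (measurable_itv `[0 : R, 1[).

HB.instance Definition _ (R : realType) := Measure.on (@unit_lebesgue R).

Lemma unit_lebesgue_setT (R : realType) : unit_lebesgue [set: R] = 1%E.
Proof.
rewrite /unit_lebesgue /mrestr setTI lebesgue_measure_itv /= lte01 oppr0.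
by rewrite adde0.
Qed.

HB.instance Definition _ (R : realType) :=
  Measure_isProbability.Build _ _ _ (@unit_lebesgue R) (unit_lebesgue_setT R).

(** Left endpoint of the dyadic interval whose points in [0, 1) have binary digits starting with the
    first n bits of w. *)
Fixpoint corner (R : realType) (n : nat) (w : nat -> bool) : R :=
  if n is n'.+1 then ((w 0%N)%:R + corner R n' (fun k => w k.+1)) / 2 else 0.

Lemma digitsS (R : realType) (c r : R) k : digits c r k.+1 = digits c (expand c r) k.
Proof. by rewrite /digits iterSr. Qed.

Lemma digits_corner (R : realType) n w (r : R) :
  ((forall k, (k < n)%N -> digits 2 r k = w k) /\ 0 <= r < 1) <->
  corner R n w <= r < corner R n w + 2^-1 ^+ n.
Proof.
elim: n w r => [|n IH] w r.
  by rewrite /= add0r expr0; split=> [[]|].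
rewrite [corner _ _ _]/= exprS; set c := corner R n _; set p : R := 2^-1 ^+ n.
have e : expand 2 r = 2 * r - (digits 2 r 0)%:R.
  by rewrite /expand /digits /=; case: ifP => _; rewrite ?subr0// (_ : 2 - 1 = 1)//; ring.
split=> [[dw /andP[r0 r1]]|/andP[cr rc]].
  have : c <= expand 2 r < c + p.
    apply/IH; split=> [k kn|]; first by rewrite -digitsS dw.
    by rewrite /expand; case: (leP 2^-1 r) => h; apply/andP; split; lra.
  rewrite e dw// => /andP[h1 h2].
  by apply/andP; split; lra.
have /IH[dk /andP[h0 h1]] : c <= 2 * r - (w 0%N)%:R < c + p by apply/andP; split; lra.
have d0 : digits 2 r 0 = w 0%N.
  rewrite /digits /=; case: (w 0%N) h0 h1 => /= h0 h1;
    by [apply/idP; lra|apply/negbTE; rewrite -ltNge; lra].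
split; last by case: (w 0%N) h0 h1 => /= h0 h1; apply/andP; split; lra.
case=> [//|k] kn; rewrite digitsS e d0; exact: dk.
Qed.

Definition coin (R : realType) : probability bits R :=
  distribution (@unit_lebesgue R) (digits (2 : R)).

Lemma coin_cylinder (R : realType) n w : coin R (cylinder n w) = (2^-1 ^+ n)%:E.
Proof.
rewrite /coin /distribution /= /pushforward /unit_lebesgue /mrestr.
rewrite (_ : _ `&` _ = `[corner R n w, corner R n w + 2^-1 ^+ n[%classic).
  have p0 : (0 : R) < 2^-1 ^+ n by rewrite exprn_gt0// invr_gt0.
  rewrite lebesgue_measure_itv /= lte_fin ltrDl p0 -EFinB; congr EFin; ring.
apply/seteqP; split => r /=; rewrite !in_itv /=.
  by move=> h; apply/digits_corner.
by move=> /digits_corner.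
Qed.

Lemma fair_coin (R : realType) : fair (coin R).
Proof. by move=> n w; rewrite !coin_cylinder. Qed.

(** * The Cantor embedding and the standard Borel property *)

Definition ternary_sum (R : realType) (n : nat) (x : nat -> bool) : R :=
  \sum_(k < n) 2 * (x k)%:R * 3^-1 ^+ k.+1.

(** The coding of bit sequences by the Cantor set. It serves both as the Borel embedding into the
    line and as the weights of the semimetric. *)
Definition ternary (R : realType) (x : nat -> bool) : R :=
  limn (fun n => ternary_sum R n x).

Lemma ternary_sumS (R : realType) n x :
  ternary_sum R n.+1 x = (2 * (x 0%N)%:R + ternary_sum R n (fun k => x k.+1)) / 3.
Proof.
rewrite /ternary_sum big_ord_recl /= expr1 [RHS]mulrDl; congr (_ + _).
by rewrite big_distrl /=; apply: eq_bigr => k _; rewrite exprSr mulrA.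
Qed.

Lemma ternary_sum_le1 (R : realType) n x : ternary_sum R n x <= 1.
Proof.
elim: n x => [|n IH] x; first by rewrite /ternary_sum big_ord0.
by rewrite ternary_sumS; have := IH (fun k => x k.+1); case: (x 0%N) => /= ?; lra.
Qed.

Lemma ternary_sum_ndecr (R : realType) x :
  {homo (fun n => ternary_sum R n x) : n m / (n <= m)%N >-> n <= m}.
Proof.
apply/nondecreasing_seqP => n; rewrite /ternary_sum big_ord_recr /= lerDl.
by rewrite !mulr_ge0// exprn_ge0// invr_ge0.
Qed.

Lemma cvg_ternary (R : realType) x :
  (fun n => ternary_sum R n x) @ \oo --> ternary R x.
Proof.
apply: nondecreasing_is_cvgn; first exact: ternary_sum_ndecr.
by exists 1 => _ [n _ <-]; exact: ternary_sum_le1.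
Qed.

Lemma ternary_ge_sum (R : realType) n x : ternary_sum R n x <= ternary R x.
Proof.
apply: nondecreasing_cvgn_le; first exact: ternary_sum_ndecr.
by apply/cvg_ex; exists (ternary R x); exact: cvg_ternary.
Qed.

Lemma ternary_ge0 (R : realType) x : 0 <= ternary R x.
Proof. by have := ternary_ge_sum R 0 x; rewrite /ternary_sum big_ord0. Qed.

Lemma ternary_le1 (R : realType) x : ternary R x <= 1.
Proof.
apply: limr_le; first by apply/cvg_ex; exists (ternary R x); exact: cvg_ternary.
by near=> n; exact: ternary_sum_le1.
Unshelve. all: by end_near. Qed.

Lemma ternaryS (R : realType) x :
  ternary R x = (2 * (x 0%N)%:R + ternary R (fun k => x k.+1)) / 3.
Proof.
have h2 : (fun n => ternary_sum R n.+1 x) @ \oo -->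
    (2 * (x 0%N)%:R + ternary R (fun k => x k.+1)) / 3.
  under eq_fun do rewrite ternary_sumS.
  by apply: cvgMl; apply: cvgD; [exact: cvg_cst|exact: cvg_ternary].
have h1 : (fun n => ternary_sum R n.+1 x) @ \oo --> ternary R x.
  by have := @cvg_ternary R x; rewrite -cvg_shiftS.
exact: (cvg_unique _ h1 h2).
Qed.

(** A leading bit 0 gives a value at most 1/3 and a leading bit 1 a value at least 2/3, so the
    threshold 1/2 recovers it. *)
Lemma digits_ternary (R : realType) x : digits 3 (ternary R x) = x.
Proof.
apply/funext => k; elim: k x => [|k IH] x.
  rewrite /digits /= ternaryS; have := ternary_ge0 R (fun k => x k.+1).
  have := ternary_le1 R (fun k => x k.+1).
  by case: (x 0%N) => /= h1 h0; [apply/idP|apply/negbTE; rewrite -ltNge]; lra.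
rewrite digitsS -(IH (fun k => x k.+1)); congr (digits _ _ k).
rewrite /expand ternaryS; have := ternary_ge0 R (fun k => x k.+1).
have := ternary_le1 R (fun k => x k.+1).
by case: (x 0%N) => /= h1 h0; case: (leP 2^-1 _) => h; lra.
Qed.

Lemma measurable_ternary (R : realType) :
  measurable_fun setT (ternary R : bits -> R).
Proof.
apply: (@measurable_fun_cvg _ bits R setT (fun n (x : bits) => ternary_sum R n x)
  (ternary R)) => [n|x _].
  elim: n => [|n IH].
    rewrite (_ : ternary_sum R 0 = cst 0); first exact: measurable_cst.
    by apply/funext => x; rewrite /ternary_sum big_ord0.
  rewrite (_ : ternary_sum R n.+1 = ternary_sum R n \+
      (fun x : bits => 2 * 3^-1 ^+ n.+1 * \1_[set x : bits | x n] x)).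
    apply: measurable_funD => //; apply: measurable_funM => //.
    exact: measurable_indic (measurable_bit n).
  apply/funext => x; rewrite /ternary_sum big_ord_recr /= indicE mulrAC.
  congr (_ + _ * _%:R); congr nat_of_bool.
  by apply/idP/idP => [h|/set_mem//]; exact: mem_set.
exact: cvg_ternary.
Qed.

Lemma standard_borel_bits (R : realType) : standard_borel R bits.
Proof.
exists (ternary R); split=> [x x' e||A mA].
- by rewrite -(digits_ternary R x) e digits_ternary.
- exact: measurable_ternary.
(* The measurable left inverse [digits 3] turns the image of A into a measurable condition on r. *)
- rewrite (_ : _ @` _ = (digits (3 : R) @^-1` A) `&`
      [set r | ternary R (digits 3 r) = r]); last first.
    apply/seteqP; split => [_ [x Ax <-]|r [/= Ar <-]]; last by exists (digits 3 r).
    by rewrite /= !digits_ternary.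
  have md := measurable_digits (3 : R); apply: measurableI.
    by rewrite -[X in measurable X]setTI; exact: md.
  have mf : measurable_fun setT (fun r : measurableTypeR R => ternary R (digits 3 r) - r).
    apply: measurable_funB; last exact: measurable_id.
    exact: (measurableT_comp (@measurable_ternary R) md).
  rewrite (_ : [set r | _] = (fun r => ternary R (digits 3 r) - r) @^-1` [set 0]).
    by rewrite -[X in measurable X]setTI; exact: mf.
  by apply/seteqP; split => r /= h; apply/eqP; [rewrite subr_eq0 h|rewrite -subr_eq0 h].
Qed.

(** * Ergodicity *)

Lemma carries0P y : carries y = 0%N <-> forall l, y l.
Proof.
rewrite /carries; case: pselect => [e|ne].
  by case: ex_minnP => v nyv _; split=> // /(_ v); rewrite (negbTE nyv).
by split=> // _ l; apply: contraT => nyl; case: ne; exists l.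
Qed.

Lemma carriesSP y v : carries y = v.+1 <-> carry y v /\ ~~ y v.
Proof.
split=> [e|[cv nyv]].
  have nc : exists m, ~~ carry y m.
    apply: contrapT => nc; suff : carries y = 0%N by rewrite e.
    apply/carries0P => l; apply: contraT => nyl; case: nc.
    by exists l.+1; rewrite /= negb_and nyl orbT.
  have [m /carriesP h] := nc; rewrite -h e ltnSn; split=> //.
  by apply/negP => yv; have := h v.+1; rewrite e ltnn /= yv -h e ltnSn.
have nc : ~~ carry y v.+1 by rewrite /= negb_and nyv orbT.
have h := carriesP nc.
apply/eqP; rewrite eqn_leq leqNgt h nc/=.
by have := h v; rewrite cv.
Qed.

(** The translation that [skew] performs where [carries] equals v. For v = 0, the point of all ones,
    it flips every digit and no fibre bit. *)
Definition step (v : nat) : nat -> bool :=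
  fun k => if odd k then level_parity v k./2 else (v == 0%N) || (k./2 < v)%N.

Lemma skewE x : skew x = flip (step (carries (base x))) x.
Proof.
apply/funext => k; rewrite /skew /flip /step addbC; congr (_ (+) _).
case: ifP => // _; case e: carries => [|v] /=.
  by apply/carryP => l _; move/carries0P: e.
apply/esym; rewrite -e; apply: (@carriesP _ v.+1).
by move/carriesSP: e => [_ nv]; rewrite /= negb_and nv orbT.
Qed.

(** Complementing all digits turns adding 1 into subtracting 1, so conjugation by this flip inverts
    [skew]. *)
Definition evens (k : nat) : bool := ~~ odd k.

(** The two flips together fix the first v digits, or all digits if v = 0, and these decide whether
    [carries] is v. *)
Lemma carries_step v x :
  (carries (base (flip evens (flip (step v) x))) == v) = (carries (base x) == v).
Proof.
have e l : base (flip evens (flip (step v) x)) l = base x l (+) ((v == 0%N) || (l < v)%N) (+) true.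
  by rewrite /base /flip /evens /step odd_double /= doubleK; case: (x _); case: orb.
case: v e => [|v] e.
  apply/eqP/eqP => /carries0P h; apply/carries0P => l; have := h l; rewrite e /=;
    by case: base.
have e' l : (l <= v)%N -> base (flip evens (flip (step v.+1) x)) l = base x l.
  by move=> lv; rewrite e /= ltnS lv; case: base.
apply/eqP/eqP => /carriesSP h; apply/carriesSP; move: h; rewrite e'//;
  by rewrite (eq_carry (fun l lv => e' l (ltnW lv))).
Qed.

Lemma flipC g h x : flip g (flip h x) = flip h (flip g x).
Proof. by apply/funext => k; rewrite /flip addbCA. Qed.

Lemma skew_evens_skew x : skew (flip evens (skew x)) = flip evens x.
Proof.
set v := carries (base x).
have e : carries (base (flip evens (skew x))) = v.
  by apply/eqP; rewrite skewE carries_step.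
by rewrite skewE e skewE -/v (flipC (step v)) flipK.
Qed.

Definition carries_set (v : nat) : set bits := [set x | carries (base x) = v].

Lemma measurable_carries_set v : measurable (carries_set v).
Proof.
have mc m : measurable [set x : bits | carry (base x) m].
  elim: m => [|m IH].
    by rewrite (_ : [set _ | _] = setT)//; apply/seteqP; split.
  rewrite (_ : [set _ | _] = [set x : bits | carry (base x) m] `&` [set x : bits | x m.*2]).
    by apply: measurableI => //; exact: measurable_bit.
  by apply/seteqP; split => x /= => [/andP[]|[-> ?]].
case: v => [|v].
  rewrite (_ : carries_set 0 = \bigcap_(l in setT) [set x : bits | x l.*2]).
    by apply: bigcap_measurableType => l _; exact: measurable_bit.
  apply/seteqP; split => x /=; first by move=> /carries0P h l _; exact: h.
  by move=> h; apply/carries0P => l; exact: h.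
rewrite (_ : carries_set _ = [set x : bits | carry (base x) v] `&` [set x : bits | x v.*2 = false]).
  by apply: measurableI => //; exact: measurable_bitE.
apply/seteqP; split => x /=; first by move=> /carriesSP[-> /negbTE].
by move=> [h1 h2]; apply/carriesSP; split=> //; rewrite /base h2.
Qed.

(** The pieces are described by conditions on the image point, so that the sets being translated
    partition A. *)
Lemma skew_preimage (A : set bits) :
  skew @^-1` A = \bigcup_v (flip (step v) @^-1` (A `&` (flip evens @^-1` carries_set v))).
Proof.
apply/seteqP; split => x /=.
  move=> Ax; exists (carries (base x)) => //; split; first by rewrite -skewE.
  by apply/eqP; rewrite carries_step.
move=> [v _ [Ax /eqP]]; rewrite carries_step => /eqP e.
by rewrite skewE e.
Qed.

Lemma measurable_skew : measurable_fun setT (skew : bits -> bits).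
Proof.
move=> _ A mA; rewrite setTI skew_preimage; apply: bigcupT_measurable => v.
apply: measurable_funPTI; apply: measurableI => //.
by apply: measurable_funPTI; exact: measurable_carries_set.
Qed.

Lemma skew_invertible : invertible_measurable (skew : bits -> bits).
Proof.
split; first exact: measurable_skew.
exists (flip evens \o skew \o flip evens); split.
- apply: measurableT_comp; last exact: measurable_flip.
  by apply: measurableT_comp; [exact: measurable_flip|exact: measurable_skew].
- by move=> x /=; rewrite skew_evens_skew flipK.
- by move=> x /=; rewrite skew_evens_skew flipK.
Qed.

(* [skew] is piecewise a flip, and the images of the pieces partition the space. *)
Lemma skew_preserving (R : realType) (mu : probability bits R) :
  fair mu -> measure_preserving mu (skew : bits -> bits).
Proof.
move=> fmu A mA; pose E v : set bits := A `&` (flip evens @^-1` carries_set v).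
have mE v : measurable (E v).
  apply: measurableI => //; apply: measurable_funPTI; exact: measurable_carries_set.
have tE : trivIset setT E.
  by apply/trivIsetP => i j _ _ ij; apply/seteqP; split => // x [[_ /= h1] [_ /= h2]];
    move: ij; rewrite -h1 -h2 eqxx.
rewrite skew_preimage measure_bigcup; last 2 first.
- by move=> v _; apply: measurable_funPTI; exact: mE.
- apply/trivIsetP => i j _ _ ij; apply/seteqP; split => // x [[_ /= /eqP h1] [_ /= /eqP h2]].
  by move: h1 h2 ij; rewrite !carries_step => /eqP <- /eqP <-; rewrite eqxx.
rewrite [in RHS](_ : A = \bigcup_v E v); last first.
  apply/seteqP; split => x; last by case=> v _ [].
  by move=> Ax; exists (carries (base (flip evens x))).
rewrite measure_bigcup//; apply: eq_eseriesr => v _.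
exact: (fair_probability_flip (step v) fmu (mE v)).
Qed.

(** * Translations along orbits and ergodicity *)

(* Adding 2^m to a point with y_m = 0 flips y_m and the fibre bit [level m]; these
   flips generate a dense group of translations, whence ergodicity. *)
Definition generator (m : nat) : nat -> bool :=
  fun k => (k == m.*2) || (k == (level m).*2.+1).

Lemma iter_skew_generator m x : ~~ base x m -> iter (2 ^ m) skew x = flip (generator m) x.
Proof.
move=> xm; have [eb ef] := iter_skew_flip xm.
apply/funext => k; rewrite /flip /generator addbC.
have := eb k./2; have := ef k./2; rewrite /base /fiber.
have := odd_double_half k; case: (odd k) => /= <-.
- rewrite add1n /= uphalf_double => -> _; congr (_ (+) _).
  by apply/eqP/orP => [->|[]/eqP]; [right|lia|lia].
- rewrite add0n doubleK => _ ->; congr (_ (+) _).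
  by apply/eqP/orP => [->|[]/eqP]; [left|lia|lia].
Qed.

Lemma level_infinite i c : exists2 m, (c <= m)%N & level m = i.
Proof.
(* The bound 2 gives a < a * a, so a lies in its own block. *)
have [a ca h] := level_block i (maxn c 2); exists a; first by lia.
by apply: h; rewrite leqnn /=; nia.
Qed.

(** An invariant set A is preserved by translations that flip a prescribed coordinate and otherwise
    only later ones. Hence the restriction of [mu] to A is fair, and by uniqueness it equals [mu A]
    times [mu]. *)
Lemma skew_ergodic (R : realType) (mu : probability bits R) :
  fair mu -> ergodic mu (skew : bits -> bits).
Proof.
move=> fmu A mA TA.
have iterA k x : A (iter k skew x) <-> A x.
  by elim: k => //= k IH; rewrite -[A (skew _)]/((skew @^-1` A) _) TA.
have genA m x : A (flip (generator m) x) <-> A x.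
  case xm : (base x m); last by rewrite -iter_skew_generator ?xm.
  (* If the digit m is 1, the translated point has digit 0 there and is carried to x. *)
  rewrite -[x in X in _ <-> X](flipK (generator m)) -[X in _ <-> A X]iter_skew_generator ?iterA//.
  by rewrite /base /flip /generator eqxx /=; move: xm; rewrite /base => ->.
have singleA k : exists g, (forall x, A (flip g x) <-> A x) /\
    forall l, (l <= k)%N -> g l = (l == k).
  have := odd_double_half k; case: (odd k) => /= e.
    (* A fibre coordinate k: take a generator of that level whose digit lies beyond k. *)
    have [m km lm] := level_infinite k./2 k; exists (generator m); split=> [x|l lk].
      exact: genA.
    by rewrite /generator lm -[in RHS]e add1n (_ : l == m.*2 = false)//; apply/negP => /eqP; lia.
  (* A base coordinate k: a second generator of the same level, with a far digit, cancels the change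
     in the fibre. *)
  have [m km lm] := level_infinite (level k./2) k.+1.
  exists (flip (generator m) (generator k./2)); split=> [x|l lk].
    rewrite (_ : flip _ x = flip (generator m) (flip (generator k./2) x)) ?genA//.
    by apply/funext => r; rewrite /flip addbA.
  rewrite /flip /generator lm.
  have -> : (l == m.*2) = false by apply/negP => /eqP; lia.
  have -> : k./2.*2 = k by lia.
  case: (eqVneq l k) => [->|_] /=; last by rewrite addbb.
  by rewrite (_ : k == _ = false)//; apply/negP => /eqP; lia.
have fA : (0 <= fine (mu A))%R by exact: fine_ge0.
pose m2 := mscale (NngNum fA) mu.
have E : forall B : set bits, measurable B -> mrestr mu mA B = m2 B.
  apply: fair_measure_unique.
  - move=> n w; rewrite /mrestr /=; have [g [gA gn]] := singleA n.
    rewrite -[RHS](@fair_probability_flip _ _ g); last 2 first.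
    + exact: fmu.
    + by apply: measurableI => //; exact: measurable_cylinder.
    congr (mu _); rewrite preimage_setI flip_cylinder; congr (_ `&` _).
      by apply/seteqP; split => x /= h k kn; rewrite h// /flip /single gn.
    by apply/seteqP; split => x /= /gA.
  - by move=> n w; rewrite /m2 /mscale /=; congr (_ * _)%E; exact: fmu.
  - rewrite /= /mrestr setTI; exact: le_lt_trans (probability_le1 _ mA) (ltry 1).
  - rewrite /= /mrestr setTI /m2 /mscale /= probability_setT mule1 fineK//.
    exact: fin_num_measure.
(* At the set A itself the identity says that a = a * a for a the measure of A. *)
have := E _ mA; rewrite /mrestr setIid /m2 /mscale /=.
have : mu A \is a fin_num by exact: fin_num_measure.
case: (mu A) fA {m2 E} => [a||] //= a0 _.
rewrite -EFinM => -[] h; have : a * (a - 1) = 0 by rewrite mulrBr -h mulr1 subrr.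
by move/eqP; rewrite mulf_eq0 subr_eq0 => /orP[/eqP->|/eqP->]; [left|right].
Qed.

Lemma skew_ergodic_system (R : realType) (mu : probability bits R) :
  fair mu -> ergodic_system mu (skew : bits -> bits).
Proof.
move=> fmu; split.
- exact: standard_borel_bits.
- exact: skew_invertible.
- exact: skew_preserving.
- exact: skew_ergodic.
Qed.

(** * Entropy *)

Lemma eps_decomposition_le (R : realType) (d : measure_display)
    (X : measurableType d) (mu : probability X R) (rho : X * X -> R) (delta eps : R) k :
  delta <= eps -> eps_decomposition mu rho delta k -> eps_decomposition mu rho eps k.
Proof.
move=> de [k0 [A [mA cA A0 dA]]]; split=> //; exists A; split=> // [|i i0].
  by apply: lt_le_trans A0 _; rewrite lee_fin.
by apply: lt_le_trans (dA i i0) _; rewrite lee_fin.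
Qed.

Lemma le_log2 (R : realType) (x y : R) : 0 < x -> x <= y -> log2 x <= log2 y.
Proof.
move=> x0 xy; rewrite /log2 ler_pM2r ?invr_gt0 ?ln_gt0 ?ltr1n//.
by rewrite ler_ln ?posrE//; exact: lt_le_trans xy.
Qed.

Lemma log2_pow (R : realType) m : log2 ((2 ^ m)%:R : R) = m%:R.
Proof.
have l2 : 0 < ln (2 : R) by rewrite ln_gt0// ltr1n.
by rewrite /log2 natrX lnXn// mulrnAl divff ?gt_eqF.
Qed.

Lemma eps_entropy_le (R : realType) (d : measure_display)
    (X : measurableType d) (mu : probability X R) (rho : X * X -> R) (eps : R) m :
  eps_decomposition mu rho eps (2 ^ m) -> (eps_entropy mu rho eps <= m%:R%:E)%E.
Proof.
move=> dm; rewrite /eps_entropy; case: pselect => [ex|[]]; last by exists (2 ^ m)%N; apply/asboolP.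
case: ex_minnP => k /asboolP[k0 _] kmin; rewrite lee_fin -(log2_pow R m).
by rewrite le_log2 ?ltr0n// ler_nat kmin//; apply/asboolP.
Qed.

Lemma eps_entropy_ge (R : realType) (d : measure_display)
    (X : measurableType d) (mu : probability X R) (rho : X * X -> R) (eps : R) m :
  (forall k, eps_decomposition mu rho eps k -> (2 ^ m <= k)%N) ->
  (m%:R%:E <= eps_entropy mu rho eps)%E.
Proof.
move=> dm; rewrite /eps_entropy; case: pselect => [ex|_]; last by rewrite leey.
case: ex_minnP => k /asboolP/dm mk _; rewrite lee_fin -(log2_pow R m).
by rewrite le_log2 ?ltr0n ?expn_gt0// ler_nat.
Qed.

Lemma eps_entropy_antitone (R : realType) (d : measure_display)
    (X : measurableType d) (mu : probability X R) (rho : X * X -> R) (delta eps : R) :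
  delta <= eps -> (eps_entropy mu rho eps <= eps_entropy mu rho delta)%E.
Proof.
move=> de; rewrite {2}/eps_entropy; case: pselect => [ex|_]; last by rewrite leey.
case: ex_minnP => k /asboolP dk _; have dk' := eps_decomposition_le de dk.
rewrite /eps_entropy; case: pselect => [ex'|[]]; last by exists k; apply/asboolP.
case: ex_minnP => k' /asboolP[k0 _] kmin; rewrite lee_fin.
by rewrite le_log2 ?ltr0n// ler_nat kmin//; apply/asboolP.
Qed.

(** The joint level sets of the tests are the cells and the exceptional set is empty. The gap
    between [e] and [eps] is there because a diameter is a supremum. *)
Lemma decomposition_of_tests (R : realType) (d : measure_display)
    (X : measurableType d) (mu : probability X R) (rho : X * X -> R) (eps e : R)
    (J : finType) (test : J -> X -> bool) :
  0 < eps -> e < eps ->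
  (forall j, measurable [set x : X | test j x]) ->
  (forall x x' : X, (forall j, test j x = test j x') -> rho (x, x') <= e) ->
  eps_decomposition mu rho eps (2 ^ #|J|).
Proof.
move=> eps0 eeps mt small; split; first by rewrite expn_gt0.
pose I : finType := {ffun J -> bool}.
have cI : #|I| = (2 ^ #|J|)%N by rewrite card_ffun card_bool.
pose cell (c : I) : set X := [set x : X | forall j, test j x = c j].
pose A (i : 'I_(2 ^ #|J|).+1) : set X :=
  if unlift ord0 i is Some j then cell (enum_val (cast_ord (esym cI) j)) else set0.
have mcell c : measurable (cell c).
  rewrite (_ : cell c = \bigcap_(j in [set: J]) [set x : X | test j x = c j]).
    apply: fin_bigcap_measurable => // j _; case: (c j); first exact: mt.
    rewrite (_ : [set _ | _] = ~` [set x : X | test j x]); first exact: measurableC.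
    by apply/seteqP; split => x /=; case: (test j x).
  by apply/seteqP; split => x /= h j; [move=> _|]; exact: h.
exists A; split => [i||/=|i i0].
- by rewrite /A; case: unlift => [j|].
- apply/seteqP; split => // x _.
  pose c : I := [ffun j => test j x].
  exists (lift ord0 (cast_ord cI (enum_rank c))) => //.
  rewrite /A liftK (_ : cast_ord _ _ = enum_rank c); last exact: val_inj.
  by rewrite enum_rankK => j; rewrite ffunE.
- by rewrite /A unlift_none measure0 lte_fin.
- rewrite eq_sym in i0; have [j _ ij] := unlift_some i0.
  rewrite /A ij.
  apply: (@le_lt_trans _ _ e%:E); last by rewrite lte_fin.
  apply: ge_ereal_sup => _ [[x x'] [/= h h'] <-]; rewrite lee_fin.
  by apply: small => r; rewrite h h'.
Qed.

(** The exceptional set has mass below 1/2, so k sets of mass at most 2^-(n+1) must cover more than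
    1/2. *)
Lemma eps_decomposition_card_ge (R : realType) (d : measure_display)
    (X : measurableType d) (mu : probability X R) (rho : X * X -> R) (eps : R) k n :
  eps <= 2^-1 ->
  (forall A : set X, measurable A -> (diam rho A < eps%:E)%E ->
     ((2 ^ n.+1)%:R%:E * mu A <= 1)%E) ->
  eps_decomposition mu rho eps k -> (2 ^ n <= k)%N.
Proof.
move=> eps2 small [k0 [A [mA cA A0 dA]]].
pose F m := A (inord m).
have p0 : (0 : R) < (2 ^ n.+1)%:R by rewrite ltr0n expn_gt0.
have muF m : (m < k)%N -> (mu (F m.+1) <= ((2 ^ n.+1)%:R^-1)%:E)%E.
  move=> mk; have i0 : inord m.+1 != ord0 :> 'I_k.+1.
    by apply/eqP => /(congr1 val); rewrite /= inordK.
  have := small _ (mA _) (dA _ i0).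
  have fin := fin_num_measure mu _ (mA (inord m.+1)).
  rewrite /F -(fineK fin) -EFinM !lee_fin => h.
  by rewrite -ler_pdivlMl// mulr1 in h.
have := Boole_inequality mu (fun i (_ : (i < k.+1)%N) => mA (inord i)).
rewrite (_ : \big[setU/set0]_(i < k.+1) _ = setT); last first.
  apply/seteqP; split => // x _; rewrite -(bigcup_mkord k.+1 F).
  have : (\bigcup_i A i) x by rewrite cA.
  by case=> i _ Ax; exists i => //=; rewrite /F inord_val.
rewrite [X in (X <= _)%E](_ : _ = 1%E); last exact: (probability_setT mu).
rewrite big_ord_recl /= => h1.
have h2 : (\sum_(i < k) mu (A (inord (bump 0 i))) <= (k%:R * (2 ^ n.+1)%:R^-1)%:E)%E.
  apply: (@le_trans _ _ (\sum_(i < k) ((2 ^ n.+1)%:R^-1)%:E)%E).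
    by apply: lee_sum => i _; exact: muF.
  by rewrite sumEFin sumr_const card_ord mulr_natl.
have h3 : (mu (A (inord 0)) < eps%:E)%E.
  by rewrite (_ : inord 0 = ord0)//; apply: val_inj; rewrite /= inordK.
have : (1 < (2^-1 + k%:R * (2 ^ n.+1)%:R^-1)%:E :> \bar R)%E.
  apply: le_lt_trans h1 _; rewrite EFinD; apply: lte_leD => //.
    by rewrite ge0_fin_numE ?sume_ge0//; apply: le_lt_trans h2 (ltry _).
  by apply: lt_le_trans h3 _; rewrite lee_fin.
rewrite lte_fin => h; have : 2^-1 < k%:R / (2 ^ n.+1)%:R :> R by lra.
rewrite ltr_pdivlMr// expnS natrM mulKf ?pnatr_eq0// ltr_nat.
exact: ltnW.
Qed.

(** * The semimetric and its averages *)

Lemma ternary_prefix (R : realType) n x :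
  (forall k, (k < n)%N -> ~~ x k) -> ternary R x <= 3^-1 ^+ n.
Proof.
elim: n x => [|n IH] x x0; first by rewrite expr0 ternary_le1.
rewrite ternaryS (negbTE (x0 0%N _))//= mulr0 add0r exprSr ler_pM2r ?invr_gt0//.
by apply: IH => k kn; exact: x0.
Qed.

Lemma ternary_ge (R : realType) i x : x i -> 3^-1 ^+ i.+1 <= ternary R x.
Proof.
elim: i x => [|i IH] x xi; rewrite ternaryS.
  by rewrite xi expr1; have := ternary_ge0 R (fun k => x k.+1) => /= ?; lra.
rewrite exprSr ler_pM2r ?invr_gt0//; have := IH (fun k => x k.+1) xi.
by case: (x 0%N) => /= ?; lra.
Qed.

Lemma ternary_subadditive (R : realType) x y (z : nat -> bool) :
  (forall k, x k -> y k || z k) -> ternary R x <= ternary R y + ternary R z.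
Proof.
move=> xyz; apply: limr_le; first by apply/cvg_ex; exists (ternary R x); exact: cvg_ternary.
near=> n; apply: le_trans (lerD (ternary_ge_sum R n y) (ternary_ge_sum R n z)).
rewrite /ternary_sum -big_split /=; apply: ler_sum => k _.
rewrite -mulrDl -mulrDr ler_wpM2r ?exprn_ge0 ?invr_ge0// ler_wpM2l// -natrD ler_nat.
by have := xyz k; case: (x k) => // /(_ isT); case: (y k); case: (z k).
Unshelve. all: by end_near. Qed.

Definition fiber_dist (R : realType) (p : bits * bits) : R :=
  ternary R (fun i => fiber p.1 i (+) fiber p.2 i).

Lemma fiber_dist_semimetric (R : realType) : measurable_semimetric (fiber_dist R).
Proof.
split.
- have md : measurable_fun setT
      (fun p : bits * bits => (fun i => fiber p.1 i (+) fiber p.2 i) : bits).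
    apply: measurable_to_bits => k.
    have m1 b : measurable [set p : bits * bits | fiber p.1 k = b].
      rewrite -[X in measurable X]setTI.
      exact: (measurable_fst measurableT _ (measurable_bitE k.*2.+1 b)).
    have m2 b : measurable [set p : bits * bits | fiber p.2 k = b].
      rewrite -[X in measurable X]setTI.
      exact: (measurable_snd measurableT _ (measurable_bitE k.*2.+1 b)).
    rewrite (_ : [set _ | _] =
        ([set p : bits * bits | fiber p.1 k = true] `&` [set p | fiber p.2 k = false]) `|`
        ([set p : bits * bits | fiber p.1 k = false] `&` [set p | fiber p.2 k = true])).
      by apply: measurableU; apply: measurableI.
    apply/seteqP; split => p /=; case: (fiber p.1 k); case: (fiber p.2 k) => //=;
      by [left|right|move=> [[]|[]]].
  exact: (measurableT_comp (@measurable_ternary R) md).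
- by move=> x y; exact: ternary_ge0.
- by move=> x y; rewrite /fiber_dist /=; congr ternary; apply/funext => i; rewrite addbC.
- move=> x y z; apply: ternary_subadditive => k /=.
  by case: (fiber x k); case: (fiber y k); case: (fiber z k).
Qed.

Lemma measurable_iter_skew k : measurable_fun setT (iter k skew : bits -> bits).
Proof.
elim: k => [|k IH]; first exact: measurable_id.
exact: (measurableT_comp measurable_skew IH).
Qed.

(** Outside the exceptional times only bits from N on can differ, which costs at most 3^-N; the
    exceptional times have proportion at most 2^-q and cost at most 1 each. *)
Lemma averaged_le (R : realType) N a b q (x x' : bits) :
  (a <= b)%N -> (q <= b)%N ->
  (forall l, (a <= l < b)%N -> (N <= level l)%N) ->
  (forall l, (l < a)%N -> base x l = base x' l) ->
  (forall l, (b - q <= l < b)%N -> base x l = base x' l) ->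
  (forall i, (i < N)%N -> fiber x i = fiber x' i) ->
  (forall i, (i < N)%N ->
    fiber (iter (2 ^ b) skew x) i = fiber (iter (2 ^ b) skew x') i) ->
  averaged (skew : bits -> bits) (2 ^ b) (fiber_dist R) (x, x') <= 3^-1 ^+ N + 2^-1 ^+ q.
Proof.
move=> ab qb lev low high f0 fT.
have [B [Bq Bf]] := skew_agreement ab qb lev low high f0 fT.
have n0 : (0 : R) < (2 ^ b)%:R by rewrite ltr0n expn_gt0.
rewrite /averaged /= ler_pdivrMl//.
apply: (@le_trans _ _ (\sum_(k < 2 ^ b) (3^-1 ^+ N + (B k)%:R))).
  apply: ler_sum => k _; rewrite /fiber_dist /=; case Bk : (B k).
    by apply: le_trans (ternary_le1 _ _) _; rewrite /= lerDr exprn_ge0 ?invr_ge0.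
  rewrite addr0; apply: ternary_prefix => i iN.
  by rewrite (Bf k i)// ?Bk// addbb.
rewrite big_split /= sumr_const card_ord -[X in _ + X]natr_sum mulrDr.
rewrite [X in X + _](_ : _ = (2 ^ b)%:R * 3^-1 ^+ N); last by rewrite mulr_natl.
rewrite lerD2l (_ : (2 ^ b)%:R * 2^-1 ^+ q = (2 ^ (b - q))%:R) ?ler_nat//.
rewrite (_ : (2 ^ b)%:R = (2 ^ (b - q))%:R * 2 ^+ q :> R).
  by rewrite exprVn mulfK// expf_neq0.
by rewrite -natrX -natrM -expnD subnK.
Qed.

(** At one time in sixteen at least, the i-th fibre bits differ and contribute 3^-(i+1) or more. *)
Lemma averaged_ge (R : realType) b v i (x x' : bits) :
  (v.+1 < b)%N -> level v = i -> level v.+1 = i ->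
  (forall l, (l < v)%N -> base x l = base x' l) -> base x v != base x' v ->
  3^-1 ^+ i.+1 / 16 <= averaged (skew : bits -> bits) (2 ^ b) (fiber_dist R) (x, x').
Proof.
move=> vb lv lv1 low xv; have := skew_separates vb lv lv1 low xv.
have n0 : (0 : R) < (2 ^ b)%:R by rewrite ltr0n expn_gt0.
rewrite -(ler_nat R) natrM natr_sum => sep.
rewrite /averaged /= ler_pdivlMl//.
set D := \sum_(k < 2 ^ b) _ in sep.
apply: (@le_trans _ _ (3^-1 ^+ i.+1 * D)).
  rewrite mulrCA ler_wpM2l ?exprn_ge0 ?invr_ge0//.
  by rewrite ler_pdivrMr// mulrC.
rewrite /D big_distrr /=; apply: ler_sum => k _.
case: eqVneq => h /=; first by rewrite mulr0 ternary_ge0.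
rewrite mulr1; apply: ternary_ge => /=.
by move: h; case: fiber; case: fiber.
Qed.

(** * Entropy bounds along a block *)

(* Flipping the digit a + n - 1 maps A to a disjoint set of the same measure, and
   the union satisfies the hypothesis for n - 1. *)
Lemma separated_measure (R : realType) (mu : probability bits R) a n (A : set bits) :
  fair mu -> measurable A ->
  (forall x x', A x -> A x' -> (forall l, (l < a)%N -> base x l = base x' l) ->
     forall l, (l < a + n)%N -> base x l = base x' l) ->
  ((2 ^ n)%:R%:E * mu A <= 1)%E.
Proof.
move=> fmu; elim: n A => [|n IH] A mA sep.
  by rewrite expn0 mul1e probability_le1.
pose t := single (a + n).*2.
have bt x l : base (flip t x) l = (l == a + n)%N (+) base x l.
  rewrite /base /flip /t /single; congr (_ (+) _).
  by apply/eqP/eqP => [|->//]; lia.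
have mtA : measurable (flip t @^-1` A) by exact: measurable_funPTI.
have disj : A `&` (flip t @^-1` A) = set0.
  apply/seteqP; split => // x [Ax /= Atx].
  have h := sep _ _ Ax Atx.
  have : base x (a + n) = base (flip t x) (a + n).
    apply: h; last by rewrite addnS.
    by move=> l la; rewrite bt (_ : l == _ = false)//; lia.
  by rewrite bt eqxx; case: base.
have : ((2 ^ n)%:R%:E * mu (A `|` flip t @^-1` A) <= 1)%E.
  apply: IH; first exact: measurableU.
  have low x l : (l < a + n)%N -> base (flip t x) l = base x l.
    by move=> ln; rewrite bt (_ : l == _ = false)//; lia.
  have low' x l : (l < a)%N -> base (flip t x) l = base x l by move=> ?; apply: low; lia.
  move=> x x' [Ax|Ax] [Ax'|Ax'] e l ln.
  - by apply: (sep _ _ Ax Ax' e); lia.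
  - rewrite -(low x')//; apply: (sep _ _ Ax Ax'); last by lia.
    by move=> r ra; rewrite low'// e.
  - rewrite -(low x)//; apply: (sep _ _ Ax Ax'); last by lia.
    by move=> r ra; rewrite low'// e.
  - rewrite -(low x)// -(low x')//; apply: (sep _ _ Ax Ax'); last by lia.
    by move=> r ra; rewrite !low'// e.
have eU : mu (A `|` flip t @^-1` A) = (mu A + mu A)%E.
  by rewrite -[X in (_ + X)%E](fair_probability_flip t fmu mA); exact: measureU.
rewrite eU expnS mulnC natrM EFinM -muleA => h; apply: le_trans h.
rewrite -(fineK (fin_num_measure mu A mA)).
rewrite -!EFinM lee_fin; set f := fine _.
by rewrite (_ : 2%:R * f = f + f)//; ring.
Qed.

Lemma exists_expr_lt (R : realType) (eps : R) :
  0 < eps -> exists N, 3^-1 ^+ N + 2^-1 ^+ N < eps.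
Proof.
move=> eps0; have e0 : 0 < 2 / eps by rewrite divr_gt0.
(* Both powers are at most 2^-N < 1/N, and N exceeds 2 / eps. *)
exists (Num.bound (2 / eps)); set N := Num.bound _.
have hN : 2 / eps < N%:R by exact: archi_boundP (ltW e0).
have N0 : (0 : R) < N%:R by exact: lt_trans hN.
have h2 : 2^-1 ^+ N < N%:R^-1 :> R.
  by rewrite exprVn ltf_pV2 ?posrE ?exprn_gt0// -natrX ltr_nat ltn_expl.
have h3 : 3^-1 ^+ N <= 2^-1 ^+ N :> R.
  by rewrite lerXn2r ?nnegrE ?invr_ge0// lef_pV2 ?posrE// ler_nat.
have h4 : 2 * N%:R^-1 < eps by rewrite ltr_pdivrMr// mulrC -ltr_pdivrMr.
lra.
Qed.

Lemma measurable_fiber i : measurable [set x : bits | fiber x i].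
Proof. exact: measurable_bit. Qed.

Lemma fiber_dist_admissible (R : realType) (mu : probability bits R) :
  admissible mu (fiber_dist R).
Proof.
split; first exact: fiber_dist_semimetric.
move=> eps eps0; have [N hN] := exists_expr_lt eps0.
apply: le_lt_trans (ltry (#|'I_N|)%:R); apply: eps_entropy_le.
apply: (@decomposition_of_tests _ _ bits mu (fiber_dist R) eps (3^-1 ^+ N) 'I_N
  (fun i x => fiber x i)) => //.
- by apply: le_lt_trans hN; rewrite lerDl exprn_ge0 ?invr_ge0.
- by move=> i; exact: measurable_fiber.
- by move=> x x' e; apply: ternary_prefix => k kN /=; rewrite (e (Ordinal kN)) addbb.
Qed.

(** The tests are the data of [skew_agreement] with q = N: a low digits, the top N digits, and N
    fibre bits at each of the times 0 and 2^b. Their number does not depend on b. *)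
Lemma averaged_entropy_le (R : realType) (mu : probability bits R) (eps : R) N a b :
  0 < eps -> 3^-1 ^+ N + 2^-1 ^+ N < eps -> (a <= b)%N -> (N <= b)%N ->
  (forall l, (a <= l < b)%N -> (N <= level l)%N) ->
  (eps_entropy mu (averaged (skew : bits -> bits) (2 ^ b) (fiber_dist R)) eps
     <= (a + 3 * N)%:R%:E)%E.
Proof.
move=> eps0 hN ab Nb lev; apply: eps_entropy_le.
pose J : finType := ('I_a + 'I_N + ('I_N + 'I_N))%type.
have <- : #|J| = (a + 3 * N)%N by rewrite !card_sum !card_ord; lia.
pose test (j : J) (x : bits) : bool := match j with
  | inl (inl l) => base x l
  | inl (inr l) => base x (b - N + l)
  | inr (inl i) => fiber x i
  | inr (inr i) => fiber (iter (2 ^ b) skew x) i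
  end.
apply: (@decomposition_of_tests _ _ bits mu _ eps _ J test eps0 hN).
  move=> [[l|l]|[i|i]]; [exact: measurable_bit|exact: measurable_bit|exact: measurable_fiber|].
  rewrite -[X in measurable X]setTI.
  exact: (@measurable_iter_skew (2 ^ b) measurableT _ (measurable_fiber i)).
move=> x x' e; apply: (averaged_le R ab Nb lev) => [l la|l /andP[bl lb]|i iN|i iN].
- exact: (e (inl (inl (Ordinal la)))).
- have lN : (l - (b - N) < N)%N by lia.
  by have := e (inl (inr (Ordinal lN))); rewrite /= subnKC.
- exact: (e (inr (inl (Ordinal iN)))).
- exact: (e (inr (inr (Ordinal iN)))).
Qed.

(** In a set of small diameter, points that agree below a agree on the block except possibly at its
    last digit: a first difference at l would separate them. The last digit is left out because
    separation at l also uses the digit l+1. *)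
Lemma averaged_entropy_ge (R : realType) (mu : probability bits R) (delta : R) i a n :
  fair mu -> 0 < delta -> delta <= 2^-1 -> delta <= 3^-1 ^+ i.+1 / 16 ->
  (forall l, (a <= l < a + n.+2)%N -> level l = i) ->
  (n%:R%:E <=
    eps_entropy mu (averaged (skew : bits -> bits) (2 ^ (a + n.+2)) (fiber_dist R)) delta)%E.
Proof.
move=> fmu d0 d2 di lev; apply: eps_entropy_ge => k.
apply: eps_decomposition_card_ge => // A mA dA.
apply: (@separated_measure _ mu a n.+1 A fmu mA) => x x' Ax Ax' low l ln.
elim/ltn_ind: l ln => l IH ln; case: (ltnP l a) => [/low//|al].
apply/eqP/negPn/negP => xl; suff : (delta%:E < delta%:E)%E by rewrite lte_fin ltxx.
apply: le_lt_trans dA; apply: le_trans (ereal_sup_ubound _); last by exists (x, x').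
rewrite lee_fin; apply: le_trans di _; apply: (@averaged_ge R (a + n.+2) l i) => //.
- by lia.
- by apply: lev; lia.
- by apply: lev; lia.
- by move=> r rl; apply: IH => //; lia.
Qed.

(** * Comparison of the two scales *)

Lemma entropy_growth_lt (R : realType) (mu : probability bits R) (delta eps : R) N :
  fair mu -> 0 < delta -> delta <= eps -> delta <= 2^-1 -> delta <= 3^-1 ^+ N.+1 / 16 ->
  3^-1 ^+ N + 2^-1 ^+ N < eps ->
  growth_lt (fun n => eps_entropy mu (averaged (skew : bits -> bits) n (fiber_dist R)) eps)
    (fun n => eps_entropy mu (averaged (skew : bits -> bits) n (fiber_dist R)) delta).
Proof.
move=> fmu d0 de d2 dN hN; have eps0 : 0 < eps by exact: lt_le_trans de.
split; first by exists 1 => // n _; rewrite mul1e; exact: eps_entropy_antitone.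
move=> [c [C [_ C0 h]]].
have hM := archi_boundP (ltW C0); set M := Num.bound C in hM.
(* This bound on a makes a^2 - a - 2 larger than M * (a + 3 * N), where M exceeds the supposed
   constant C. *)
have [a ca lev] := level_block N (3 * N + 2 * M + 3).
have eb : (a * a = a + (a * a - a - 2).+2)%N by nia.
have [_] := h (2 ^ (a * a))%N ltac:(by rewrite expn_gt0).
have up := @averaged_entropy_le R mu eps N a (a * a) eps0 hN
  ltac:(by nia) ltac:(by nia) (fun l hl => eq_leq (esym (lev l hl))).
have lo := @averaged_entropy_ge R mu delta N a (a * a - a - 2) fmu d0 d2 dN.
rewrite -eb in lo => hC; have := le_trans (lo lev) hC.
move=> /le_trans /(_ (lee_wpmul2l _ up)); rewrite lee_fin => /(_ (ltW C0)).
rewrite -EFinM lee_fin => key.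
have : (a * a - a - 2)%:R <= (M * (a + 3 * N))%:R :> R.
  by apply: le_trans key _; rewrite natrM ler_wpM2r// ltW.
by rewrite ler_nat; nia.
Qed.

Theorem theorem1 (R : realType) :
  exists (d : measure_display) (X : measurableType d) (mu : probability X R)
         (T : X -> X) (rho : X * X -> R),
    [/\ ergodic_system mu T,
        admissible mu rho &
        forall eps : R, 0 < eps ->
          exists delta : R, [/\ 0 < delta, delta < eps &
            growth_lt (fun n => eps_entropy mu (averaged T n rho) eps)
                      (fun n => eps_entropy mu (averaged T n rho) delta)]].
Proof.
exists _, bits, (coin R), skew, (fiber_dist R); split.
- exact: skew_ergodic_system (@fair_coin R).
- exact: fiber_dist_admissible.
move=> eps eps0; have [N hN] := exists_expr_lt eps0.
have p0 : 0 < 3^-1 ^+ N.+1 / 16 :> R by rewrite divr_gt0 ?exprn_gt0 ?invr_gt0.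
(* The three bounds give [delta < eps], an exceptional set of mass below 1/2, and the separation
   coming from the fibre bit N. *)
pose delta : R := Num.min (eps / 2) (Num.min 2^-1 (3^-1 ^+ N.+1 / 16)).
have d0 : 0 < delta by rewrite !lt_min p0 invr_gt0 ltr0n divr_gt0.
have dle : delta < eps.
  by apply: (@le_lt_trans _ _ (eps / 2)); [rewrite ge_min lexx|lra].
exists delta; split=> //; apply: (entropy_growth_lt (@fair_coin R) d0 (ltW dle) _ _ hN).
- by rewrite !ge_min lexx orbT.
- by rewrite !ge_min lexx !orbT.
Qed.
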